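(* Let $(P,\mu^P),(Q,\mu^Q)\in\mathfrak{M}_n$ be two weighted point clouds, and for $R\in O(n)$ and $\sigma\in\mathrm{ADM}(\mu^P,\mu^Q)$ write $$E(R,\sigma)=\sum_{i,j}\sigma_{i,j}\,\|p_iR-q_j\|_2^2 .$$ Let $\{(R^k,\sigma^k)\}_{k=1}^\infty$ be a sequence generated by the alternating minimization algorithm described in the context. Then for every $k\ge1$, $$E(R^{k+1},\sigma^{k+1})\le E(R^k,\sigma^k).$$
   Context: Points of $\mathbb{R}^n$ are row vectors, and $O(n)=\{R\in\mathbb{R}^{n\times n}: RR^T=I_n\}$. The space of weighted point clouds is $$\mathfrak{M}_n=\bigcup_{\ell=1}^{\infty}\Big\{(P,\mu)=\{(p_i,\mu_i)\in\mathbb{R}^n\times\mathbb{R}_+\}_{i=1}^{\ell}\ :\ \sum_{i=1}^{\ell}\mu_i=1,\ p_i\ne p_j\text{ if }i\ne j\Big\},$$ where $\mathbb{R}_+$ denotes the strictly positive reals. The symbol $P$ also denotes the $\ell_P\times n$ matrix with $i$-th row $p_i$, and $Q$ the $\ell_Q\times n$ matrix with $j$-th row $q_j$. The set of admissible transport plans is $$\mathrm{ADM}(\mu^P,\mu^Q)=\Big\{\sigma\in\mathbb{R}^{\ell_P\times\ell_Q}: \sum_j\sigma_{i,j}=\mu^P_i,\ \sum_i\sigma_{i,j}=\mu^Q_j,\ \sigma_{i,j}\ge0\Big\}.$$ Algorithm: start from an initial $R^0\in O(n)$ and $\sigma^0\in\mathrm{ADM}(\mu^P,\mu^Q)$. For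 $k=1,2,\dots$: (a) let $R^k\in\arg\min_{R\in O(n)}\sum_{i,j}\sigma^{k-1}_{i,j}\|p_iR-q_j\|_2^2$, given by $R^k=UV^T$ where $P^T\sigma^{k-1}Q=UDV^T$ is a singular value decomposition; (b) let $\sigma^k\in\arg\min_{\sigma\in\mathrm{ADM}(\mu^P,\mu^Q)}\sum_{i,j}\sigma_{i,j}\|p_iR^k-q_j\|_2^2$. *)

(* Defs.v *)
From HB Require Import structures.
From mathcomp Require Import all_boot all_order all_algebra.
From mathcomp Require Import classical_sets reals.

Set Implicit Arguments.
Unset Strict Implicit.
Unset Printing Implicit Defensive.

Import Order.TTheory GRing.Theory Num.Theory.

Local Open Scope classical_set_scope.
Local Open Scope ring_scope.

(* The support is ordered by its index, so that it can be read as a matrix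
   whose i-th row is the i-th point. *)
Record point_cloud (R : realType) (n : nat) := PointCloud {
  pc_size : nat;
  pc_points : 'M[R]_(pc_size, n);
  pc_weight : 'I_pc_size -> R;
  pc_size_gt0 : (0 < pc_size)%N;
  pc_weight_gt0 : forall i, 0 < pc_weight i;
  pc_weight_sum1 : \sum_i pc_weight i = 1;
  pc_points_inj : injective (fun i => row i pc_points)
}.

(* The library's norm on matrices is the sup norm, hence this definition. *)
Definition norm2 (R : realType) (n : nat) (v : 'rV[R]_n) : R :=
  Num.sqrt (\sum_j v 0 j ^+ 2).

Definition orthogonal_group (R : realType) (n : nat) : set 'M[R]_n :=
  [set A | A *m A^T = 1%:M].

Definition adm (R : realType) (l m : nat) (mu : 'I_l -> R) (nu : 'I_m -> R) :
    set 'M[R]_(l, m) :=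
  [set sigma | [/\ forall i, \sum_j sigma i j = mu i,
                   forall j, \sum_i sigma i j = nu j
                 & forall i j, 0 <= sigma i j]].

Definition argmin (R : realType) (T : Type) (D : set T) (f : T -> R) : set T :=
  [set x | D x /\ forall y, D y -> f x <= f y].

(* The singular values are not required to be sorted. *)
Definition is_svd (R : realType) (n : nat) (M U D V : 'M[R]_n) : Prop :=
  [/\ orthogonal_group U, orthogonal_group V,
      is_diag_mx D, forall i, 0 <= D i i & M = U *m D *m V^T].

Section Alternating.

Variables (R : realType) (n : nat) (P Q : point_cloud R n).

Definition energy (A : 'M[R]_n) (sigma : 'M[R]_(pc_size P, pc_size Q)) : R :=
  \sum_i \sum_j sigma i j *
    norm2 (row i (pc_points P) *m A - row j (pc_points Q)) ^+ 2.

Definition rotation_step (sigma : 'M[R]_(pc_size P, pc_size Q))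
    (A : 'M[R]_n) : Prop :=
  argmin (@orthogonal_group R n) (fun B => energy B sigma) A /\
  exists U D V : 'M[R]_n,
    is_svd ((pc_points P)^T *m sigma *m pc_points Q) U D V /\ A = U *m V^T.

Definition plan_step (A : 'M[R]_n)
    (sigma : 'M[R]_(pc_size P, pc_size Q)) : Prop :=
  argmin (adm (@pc_weight _ _ P) (@pc_weight _ _ Q)) (energy A) sigma.

(* A run includes the initial pair, at index 0, on which no optimality is
   assumed. *)
Definition alternating_minimization (A : nat -> 'M[R]_n)
    (sigma : nat -> 'M[R]_(pc_size P, pc_size Q)) : Prop :=
  [/\ orthogonal_group (A 0%N),
      adm (@pc_weight _ _ P) (@pc_weight _ _ Q) (sigma 0%N)
    & forall k, (1 <= k)%N ->
        rotation_step (sigma k.-1) (A k) /\ plan_step (A k) (sigma k)].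

End Alternating.

(* Main.v *)
Require Import Defs.
From mathcomp Require Import all_boot all_order all_algebra.
From mathcomp Require Import classical_sets reals.

Import Order.TTheory.

Local Open Scope ring_scope.

(** This is the descent property of block coordinate minimization. Going from
    step [k] to step [k.+1], the energy changes one variable at a time:
    [E (A k.+1) (sigma k.+1) <= E (A k.+1) (sigma k) <= E (A k) (sigma k)].
    Each inequality compares a minimizer over a fixed feasible set with the
    previous iterate, which lies in that set because it was itself produced
    by a minimization over it. *)

Theorem theorem2 (R : realType) (n : nat) (P Q : point_cloud R n)
    (A : nat -> 'M[R]_n) (sigma : nat -> 'M[R]_(pc_size P, pc_size Q))
    (hrun : alternating_minimization A sigma) (k : nat) (hk : (1 <= k)%N) :
  energy (A k.+1) (sigma k.+1) <= energy (A k) (sigma k).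
Proof.
case: hrun => _ _ step.
have [[[orthA _] _] [adm_sigma _]] := step k hk.
have [[[_ minA] _] [_ min_sigma]] := step k.+1 isT.
exact: le_trans (min_sigma _ adm_sigma) (minA _ orthA).
Qed.
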